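(* Let $n\ge 1$. Homing always terminates in at most $2^{n-1}-1$ steps: for every $\pi\in S_n$, every sequence of successive placements starting from $\pi$ has length at most $2^{n-1}-1$.
   Context: A permutation $\pi\in S_n$ is written as the sequence $\pi(1),\dots,\pi(n)$, where $\pi(i)$ is the number in the $i$th position and $\pi^{-1}(i)$ is the position of the number $i$. A number $i$ is at home if $\pi(i)=i$. If $i$ is not at home, it may be placed: $i$ is removed from its current position $\pi^{-1}(i)$ and reinserted at position $i$, the numbers in the intervening positions each shifting by one position toward the vacated position, and all other numbers staying where they are. Homing is the process of repeatedly placing numbers that are not at home (chosen arbitrarily at each step) until the identity permutation is reached; each placement is one step. *)

(* Defs.v *)
From mathcomp Require Import all_boot all_fingroup.
From mathcomp Require Import zify.

Set Implicit Arguments.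
Unset Strict Implicit.
Unset Printing Implicit Defensive.

(* A permutation s : 'S_n is read as the sequence s 0, ..., s (n - 1): s p is
   the number in position p and s^-1 i is the position of the number i.
   Positions and numbers are 0-based. *)

Definition at_home n (s : 'S_n) (i : 'I_n) : bool := s i == i.

(* The position, after the entry in position p has been removed and reinserted
   at position i, of the entry that was in position q. *)
Definition moved_pos (p i q : nat) : nat :=
  if q == p then i
  else if p < q <= i then q.-1
  else if i <= q < p then q.+1
  else q.

Lemma moved_pos_lt n (p i q : 'I_n) : moved_pos p i q < n.
Proof.
have := ltn_ord p; have := ltn_ord i; have := ltn_ord q.
by rewrite /moved_pos; do 3?[case: ifP]; lia.
Qed.

Lemma moved_pos_inj p i : injective (moved_pos p i).
Proof. by move=> q r; rewrite /moved_pos; do 6?[case: ifP]; lia. Qed.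

Definition moved_ord n (p i q : 'I_n) : 'I_n := Ordinal (moved_pos_lt p i q).

Lemma moved_ord_inj n (p i : 'I_n) : injective (moved_ord p i).
Proof. by move=> q r /(congr1 val) /moved_pos_inj /val_inj. Qed.

Definition moved_perm n (p i : 'I_n) : 'S_n := perm (@moved_ord_inj n p i).

(* perm composes from left to right, so the product below is characterised by
   place s i (moved_perm (s^-1 i) i q) = s q, see placeE. *)
Definition place n (s : 'S_n) (i : 'I_n) : 'S_n :=
  ((moved_perm ((s^-1)%g i) i)^-1 * s)%g.

Lemma placeE n (s : 'S_n) (i q : 'I_n) :
  place s i (moved_ord ((s^-1)%g i) i q) = s q.
Proof. by rewrite permM -(permE (@moved_ord_inj n _ _)) permK. Qed.

Lemma place_home n (s : 'S_n) (i : 'I_n) : at_home (place s i) i.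
Proof.
have := placeE s i ((s^-1)%g i); rewrite permKV /at_home.
have -> : moved_ord ((s^-1)%g i) i ((s^-1)%g i) = i.
  by apply: val_inj; rewrite /= /moved_pos eqxx.
by move=> /eqP.
Qed.

Definition homing_step n : rel 'S_n :=
  fun s t => [exists i : 'I_n, ~~ at_home s i && (t == place s i)].

Lemma homing_stuckP n (s : 'S_n) :
  (forall t, ~~ homing_step s t) <-> s = 1%g.
Proof.
split=> [stuck | -> t].
  apply/permP=> i; rewrite perm1; apply/eqP.
  apply: contraT => nh; case/negP: (stuck (place s i)).
  by apply/existsP; exists i; rewrite /at_home nh eqxx.
by apply/existsP=> -[i]; rewrite /at_home perm1 eqxx.
Qed.

(* Main.v *)
Require Import Defs.
From mathcomp Require Import all_boot all_fingroup.
From mathcomp Require Import zify.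

(** A placement is recorded as a letter: the number placed, and whether it
    moved left or right to reach its home.  The sequence of letters of a run is
    its word, and the bound comes from a rule that words obey.

    Placing i leftward shifts right the entries in positions i and beyond, so
    a number k > i that is at or left of its home may get to the right of it,
    whereas a number k < i that is not right of its home stays so.  Mirrored,
    only the rightward placement of a larger number can bring k to the left of
    its home.  Hence between two placements of k, the second of them leftward,
    some smaller number is placed leftward, and if the second is rightward,
    some larger number is placed rightward (valid_word).

    This rule alone bounds a word on m consecutive numbers, say a, ..., b, by
    2^m - 1 letters (game_bound).  A leftward a can only be the first
    occurrence of a, since nothing smaller unlocks it, and likewise for a
    rightward b.  Cut the word at the last such edge letter, w = u x v.  As the
    number of x is absent from u, induction gives |u| <= 2^(m-1) - 1.  In v the
    number a is only placed rightward and b only leftward; every such letter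
    except perhaps the first of each kind is charged to an unlocking letter
    inside a < . < b, and no inner letter is charged twice.  By induction
    there are at most 2^(m-2) - 1 inner letters, and x makes one of the two
    exceptions disappear, so |v| <= 2 (2^(m-2) - 1) + 1 = 2^(m-1) - 1.  If w
    has no edge letter, both exceptions may occur, but nothing needs to be added
    for u and x.

    For n numbers this is off by a factor of about 2, which the geometry recovers
    (homing_bound).  When all numbers outside an interval are at home, they
    stay there, and the entries of the interval only move inside it.  Until an
    end of the interval is first placed, the word lives on its interior, which
    has two numbers less; from then on that end is at home for good, and
    induction applies to the interval deprived of it.  With d + 1 numbers
    that makes at most (2^(d-1) - 1) + 1 + (2^(d-1) - 1) = 2^d - 1 steps. *)

Set Implicit Arguments.
Unset Strict Implicit.
Unset Printing Implicit Defensive.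

(** * Words with locked letters *)

(** The letter (true, k) is a placement of k that moves k leftward to its home,
    (false, k) one that moves it rightward. *)
Definition letter := (bool * nat)%type.

Definition unlocks (y z : letter) : bool :=
  (z.1 == y.1) && (if y.1 then z.2 < y.2 else y.2 < z.2).

(** The situation of y once its number has been placed: y can only occur again
    after a letter that unlocks it. *)
Fixpoint locked (y : letter) (w : seq letter) : bool :=
  if w is z :: w' then unlocks y z || (z != y) && locked y w' else true.

Fixpoint valid (w : seq letter) : bool :=
  if w is x :: w' then
    [&& locked (true, x.2) w', locked (false, x.2) w' & valid w']
  else true.

(** Excludes exactly the letters from outside [a, b) that can unlock a letter
    with a number in [a, b); other letters from outside are harmless.  With
    this condition the induction needs no deletion of letters from words. *)
Definition inner (a b : nat) (z : letter) : bool :=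
  if z.1 then a <= z.2 else z.2 < b.

Definition within (a b : nat) (z : letter) : bool := a <= z.2 < b.

Lemma unlocks_irr y : unlocks y y = false.
Proof. by case: y => [[] k]; rewrite /unlocks /= ltnn. Qed.

Lemma locked_prefix y u w : locked y (u ++ w) -> locked y u.
Proof.
elim: u => //= z u IHu /orP[-> // | /andP[-> /IHu ->]].
by rewrite orbT.
Qed.

Lemma locked_cat y u w : locked y (u ++ y :: w) -> has (unlocks y) u.
Proof.
elim: u => [|z u IHu] /=; first by rewrite unlocks_irr eqxx.
by case/orP=> [-> // | /andP[_ /IHu ->]]; rewrite orbT.
Qed.

Lemma valid_locked x y w : valid (x :: w) -> x.2 = y.2 -> locked y w.
Proof. by case: y => [[] k] /= /and3P[lt lf _] <-. Qed.

Lemma valid_suffix u w : valid (u ++ w) -> valid w.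
Proof. by elim: u => //= x u IHu /and3P[_ _ /IHu]. Qed.

Lemma valid_prefix u w : valid (u ++ w) -> valid u.
Proof.
by elim: u => //= x u IHu /and3P[/locked_prefix-> /locked_prefix-> /IHu].
Qed.

Lemma first_occurrence u x w :
  valid (u ++ x :: w) -> ~~ has (unlocks x) u -> all (fun z => z.2 != x.2) u.
Proof.
elim: u => //= z u IHu val /norP[_ nu].
have /IHu -> // : valid (u ++ x :: w) by case/and3P: val.
rewrite andbT; apply: contra nu => /eqP eq_zx.
exact: locked_cat (valid_locked val eq_zx).
Qed.

(** Between two occurrences of y lies a letter that unlocks y, and before the
    first one too if y starts out locked. *)
Lemma count_repeat y w : valid w ->
  count_mem y w <= count (unlocks y) w + ~~ locked y w.
Proof.
elim: w => //= z w IHw /[dup] val /and3P[_ _ /IHw{}IHw].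
have [eq_zy | _] := eqVneq z y.
  by move: IHw; rewrite eq_zy unlocks_irr (valid_locked val) ?eq_zy //=; lia.
case: (unlocks y z) => //=; lia.
Qed.

Lemma split_last (T : Type) (p : pred T) w : has p w ->
  exists u x v, [/\ w = u ++ x :: v, p x & ~~ has p v].
Proof.
elim: w => //= z w IHw.
have [/IHw[u [x [v [-> px nv]]]] _ | nw] := boolP (has p w).
  by exists (z :: u), x, v.
by rewrite orbF => pz; exists nil, z, w.
Qed.

(** The letters on the end numbers a and b that no letter with a number in
    [a, b] unlocks. *)
Definition edge (a b : nat) (z : letter) : bool :=
  (z == (true, a)) || (z == (false, b)).

(** Without edge letters, a letter on one of the end numbers a and b is
    (false, a) or (true, b), and these two are unlocked by disjoint sets of
    letters, all with a number strictly between a and b. *)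
Lemma count_edgeless a b w : all (inner a b.+1) w -> ~~ has (edge a b) w -> a < b ->
  [/\ all (inner a.+1 b) w,
   count (within a b.+1) w
     = count_mem (false, a) w + count_mem (true, b) w + count (within a.+1 b) w &
   count (unlocks (false, a)) w + count (unlocks (true, b)) w
     <= count (within a.+1 b) w].
Proof.
elim: w => //= z w IHw /andP[iz /IHw{}IHw] /norP[ez /IHw{}IHw] ab.
have [-> -> le_w] := IHw ab.
move: le_w; do 5!move: (count _ w) => ?.
move: iz ez; case: z => s k; rewrite /inner /edge /within /unlocks !xpair_eqE /=.
by case: s => /=; split; lia.
Qed.

(** The induction cuts w at its last edge letter x and steps from m to m - 1
    before x, where the number of x is absent, and to m - 2 after it. *)
Lemma game_bound m a w : valid w -> all (inner a (a + m)) w ->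
  count (within a (a + m)) w <= 2 ^ m - 1.
Proof.
elim/ltn_ind: m => -[_ |m IHm] in a w * => val int.
  rewrite addn0; rewrite (eq_count (a2 := pred0)) ?count_pred0 // => z.
  by rewrite /within /=; lia.
(* A word v without edge letters: the second bound is for v following an edge
   letter, which locks (false, a) or (true, a + m) at the start of v. *)
have tail v : valid v -> all (inner a (a + m.+1)) v -> ~~ has (edge a (a + m)) v ->
  count (within a (a + m.+1)) v <= 2 * (2 ^ m - 1) + 1 /\
  (forall x, edge a (a + m) x -> valid (x :: v) ->
    count (within a (a + m.+1)) v <= 2 ^ m - 1).
  case: m IHm {w val int} => [|m] IHm vv.
    move=> iv ev; rewrite (_ : count _ v = 0) //; apply/eqP; rewrite eqn0Ngt -has_count.
    apply/hasPn=> z zv; have := allP iv z zv; have := hasPn ev z zv.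
    by case: z {zv} => -[] k; rewrite /inner /edge /within !xpair_eqE /=; lia.
  rewrite addnS => iv ev; have ab : a < a + m.+1 by lia.
  have [iv' -> le_v] := count_edgeless iv ev ab.
  rewrite addnS -addSn in iv' le_v *.
  have := IHm m ltac:(lia) a.+1 v vv iv'.
  have := count_repeat (false, a) vv; have := count_repeat (true, a.+1 + m) vv.
  rewrite (expnS 2 m); have : 0 < 2 ^ m by rewrite expn_gt0.
  move=> pow2 repeat_b repeat_a le_mid; split; first by lia.
  move=> x ex vx.
  have : locked (false, a) v || locked (true, a.+1 + m) v.
    case/orP: ex => /eqP def_x; rewrite def_x in vx; apply/orP; [left | right].
      exact: valid_locked vx _.
    by apply: valid_locked vx _; rewrite /=; lia.
  lia.
have pow : 0 < 2 ^ m by rewrite expn_gt0.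
rewrite expnS; have [/split_last[u [x [v [def_w ex nv]]]] | nw] :=
  boolP (has (edge a (a + m)) w); last first.
  by have [le_w _] := tail w val int nw; lia.
rewrite def_w in val int *.
have /valid_prefix vu := val.
have vxv := valid_suffix val; have vv := @valid_suffix [:: x] _ vxv.
move: int; rewrite all_cat => /andP[iu /= /andP[_ iv]].
have [_ /(_ x ex vxv) le_v] := tail v vv iv nv.
have /(first_occurrence val) xu : ~~ has (unlocks x) u.
  apply/hasPn=> z zu; have := allP iu z zu; move: ex.
  by case: x {def_w val vxv} => -[] k; case: z {zu} => -[] l;
    rewrite /inner /edge /unlocks !xpair_eqE /=; lia.
have le_u : count (within a (a + m.+1)) u <= 2 ^ m - 1.
  have [c [iu' eq_u]] : exists c, all (inner c (c + m)) u /\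
    count (within a (a + m.+1)) u = count (within c (c + m)) u.
    case/orP: ex => /eqP def_x; [exists a.+1 | exists a]; split.
    - apply/allP=> z zu; move: (allP iu z zu) (allP xu z zu).
      by rewrite def_x /inner; case: (z.1) => /=; lia.
    - apply: eq_in_count => z zu; move: (allP xu z zu).
      by rewrite def_x /within /=; lia.
    - apply/allP=> z zu; move: (allP iu z zu) (allP xu z zu).
      by rewrite def_x /inner; case: (z.1) => /=; lia.
    apply: eq_in_count => z zu; move: (allP xu z zu).
    by rewrite def_x /within /=; lia.
  by rewrite eq_u; apply: IHm.
rewrite count_cat /=; case: (within _ _ x); lia.
Qed.

(** * The word of a run of homing *)

Fixpoint legal n (s : 'S_n) (ms : seq 'I_n) : bool :=
  if ms is i :: ms' then ~~ at_home s i && legal (place s i) ms' else true.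

Fixpoint word n (s : 'S_n) (ms : seq 'I_n) : seq letter :=
  if ms is i :: ms' then (i < (s^-1)%g i, i : nat) :: word (place s i) ms'
  else [::].

Lemma legal_path n (s : 'S_n) ts : path (@homing_step n) s ts ->
  exists2 ms, legal s ms & size ms = size ts.
Proof.
elim: ts s => [|t ts IHts] s /=; first by exists [::].
case/andP=> /existsP[i /andP[nh /eqP->]] /IHts[ms leg <-].
by exists (i :: ms); rewrite //= nh.
Qed.

Lemma legal_cat n (s : 'S_n) ms js :
  legal s (ms ++ js) = legal s ms && legal (foldl (@place n) s ms) js.
Proof. by elim: ms s => //= i ms IHms s; rewrite IHms andbA. Qed.

Lemma size_word n (s : 'S_n) ms : size (word s ms) = size ms.
Proof. by elim: ms s => //= i ms IHms s; rewrite IHms. Qed.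

Lemma all_word n (p : pred nat) (s : 'S_n) ms :
  all (fun z => p z.2) (word s ms) = all (fun i : 'I_n => p i) ms.
Proof. by elim: ms s => //= i ms IHms s; rewrite IHms. Qed.

Lemma at_homeE n (s : 'S_n) k : at_home s k = ((s^-1)%g k == k :> nat).
Proof.
by rewrite -[RHS]/((s^-1)%g k == k) -(inj_eq (@perm_inj _ s)) permKV eq_sym.
Qed.

Lemma pos_place n (s : 'S_n) (i k : 'I_n) :
  ((place s i)^-1)%g k = moved_pos ((s^-1)%g i) i ((s^-1)%g k) :> nat.
Proof.
have /(congr1 ((place s i)^-1)%g) := placeE s i ((s^-1)%g k).
by rewrite permKV permK => <-.
Qed.

(** While k is not right of its home, only a leftward placement of a smaller
    number can bring it there, which must happen before k is placed leftward;
    and symmetrically. *)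
Lemma word_locked n (s : 'S_n) ms (y : letter) (k : 'I_n) : legal s ms -> y.2 = k ->
    (if y.1 then (s^-1)%g k <= k else k <= (s^-1)%g k) ->
  locked y (word s ms).
Proof.
case: y => d _ leg /= -> side.
elim: ms s leg side => //= i ms IHms s /andP[nh /IHms{}IHms] side.
have pos_inj : ((s^-1)%g i == (s^-1)%g k :> nat) = (i == k :> nat).
  by rewrite !val_eqE (inj_eq perm_inj).
have [//|nu] := boolP (unlocks _ _); apply/andP; split.
  apply: contra nh; rewrite at_homeE xpair_eqE => /andP[/eqP eq_d eq_ik].
  by move: pos_inj eq_d side; rewrite eq_ik; case: (d) => /=; lia.
apply: IHms; rewrite pos_place; move: nh nu side pos_inj.
rewrite at_homeE /unlocks /moved_pos.
by case: (d) => /=; do 3?[case: ifP]; lia.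
Qed.

Lemma valid_word n (s : 'S_n) ms : legal s ms -> valid (word s ms).
Proof.
elim: ms s => //= i ms IHms s /andP[nh leg]; have := place_home s i.
by rewrite at_homeE => /eqP home; rewrite IHms // !(word_locked _ (k := i)) //= home.
Qed.

(** * Shrinking the interval of unsettled numbers *)

Definition settled n (a b : nat) (s : 'S_n) :=
  forall k : 'I_n, ~~ (a <= k < b) -> at_home s k.

Lemma settled_pos n a b (s : 'S_n) (i : 'I_n) :
  settled a b s -> a <= i < b -> a <= (s^-1)%g i < b.
Proof.
move=> st abi; apply: contraTT (abi) => /[dup] out /st.
by rewrite /at_home permKV => /eqP->.
Qed.

(** The numbers outside [a, b) fill the positions outside it, so a legal
    placement shifts only positions inside. *)
Lemma settled_place n a b (s : 'S_n) (i : 'I_n) :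
  settled a b s -> ~~ at_home s i -> settled a b (place s i).
Proof.
move=> st nh k out; rewrite at_homeE pos_place.
have := st k out; rewrite at_homeE => /eqP->.
have abi : a <= i < b by apply: contraR nh => /st.
by have := settled_pos st abi; rewrite /moved_pos; do 3?[case: ifP]; lia.
Qed.

Lemma settled_run n a b (s : 'S_n) ms :
  settled a b s -> legal s ms -> settled a b (foldl (@place n) s ms).
Proof.
elim: ms s => //= i ms IHms s st /andP[nh leg].
exact: IHms (settled_place st nh) leg.
Qed.

(** The first placement of an end of the interval [a, a + d] splits the run:
    before it only the d - 1 interior numbers are placed, after it that end
    never leaves its home. *)
Lemma homing_bound n d a (s : 'S_n) ms :
  settled a (a + d.+1) s -> legal s ms -> size ms <= 2 ^ d - 1.
Proof.
elim: d a s ms => [|d IHd] a s ms st leg.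
  case: ms leg => // i ms /= /andP[nh _]; case/negP: (nh).
  have abi : a <= i < a + 1 by apply: contraR nh => /st.
  by have := settled_pos st abi; rewrite at_homeE; lia.
have free js (t : 'S_n) : legal t js ->
    all (fun i : 'I_n => a.+1 <= i < a.+1 + d) js -> size js <= 2 ^ d - 1.
  move=> legt; rewrite -(all_word (fun k => a.+1 <= k < a.+1 + d) t) => mid.
  rewrite -(size_word t); have /eqP <- := etrans (esym (all_count _ _)) mid.
  apply: game_bound (valid_word legt) _.
  by apply: sub_all mid => z; rewrite /inner; case: (z.1); lia.
rewrite expnS; have pow : 0 < 2 ^ d by rewrite expn_gt0.
(* p selects the two ends, as legal placements stay within [a, a + d + 1]. *)
pose p (i : 'I_n) := ~~ (a.+1 <= i < a.+1 + d).
case: (boolP (has p ms)) leg => [/split_find[i js ks pi npj] | np] leg; last first.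
  suff : size ms <= 2 ^ d - 1 by lia.
  by apply: free leg _; move: np; rewrite has_predC negbK.
move: leg; rewrite cat_rcons legal_cat => /andP[legj /= /andP[nhi legk]].
have size_j : size js <= 2 ^ d - 1.
  by apply: free legj _; move: npj; rewrite has_predC negbK.
set t := place _ i in legk.
have st_t : settled a (a + d.+2) t.
  exact: settled_place (settled_run st legj) nhi.
have home_i : at_home t i := place_home _ i.
have size_k : size ks <= 2 ^ d - 1.
  have abi : a <= i < a + d.+2.
    by apply: contraR nhi; apply: settled_run st legj i.
  have [eq_i | ne_i] := eqVneq (i : nat) a.
    apply: (IHd a.+1 t) legk => k out.
    have [/val_inj-> // | ne_k] := eqVneq (k : nat) i.
    by apply: st_t; lia.
  apply: (IHd a t) legk => k out.
  have [/val_inj-> // | ne_k] := eqVneq (k : nat) i.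
  by apply: st_t; move: pi; rewrite /p; lia.
rewrite size_cat /=; lia.
Qed.

Theorem theorem5p1 (n : nat) (hn : 1 <= n) (s : 'S_n) (ts : seq 'S_n)
    (hts : path (@homing_step n) s ts) :
  size ts <= 2 ^ (n - 1) - 1.
Proof.
have [ms leg <-] := legal_path hts.
apply: (@homing_bound n (n - 1) 0 s) leg => k.
by have := ltn_ord k; lia.
Qed.
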